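(* For all sufficiently small $\epsilon>0$, the space $R^\sharp_\pi(B^3,A_1\cup A_2)$ is the disjoint union of two circles, parameterized by $\beta\in S^1=\mathbb{R}/2\pi\mathbb{Z}$ and $i=1,2$. These satisfy $$m\mapsto\mathbf i,\quad b\mapsto e^{-\tau_i(\beta)\mathbf k}e^{(\frac\pi2+\beta+\epsilon\sin\beta)\mathbf k}\mathbf i,\quad c\mapsto e^{-\tau_i(\beta)\mathbf k}e^{(\frac\pi2+\beta-\epsilon\sin\beta)\mathbf k}\mathbf i,\quad n\mapsto e^{-2\epsilon\sin(\beta)\mathbf k}\mathbf i$$ and $$a\mapsto e^{-\tau_i(\beta)\mathbf k}\mathbf i,\quad d\mapsto e^{(-\tau_i(\beta)-2\epsilon\sin(\beta))\mathbf k}\mathbf i .$$ In particular the restriction map $R^\sharp_\pi(B^3,A_1\cup A_2)\to R(S^2,\{m,b,c,n\})$ is given by $$\rho_i(\beta)=\left(-\tau_i(\beta)+\tfrac\pi2+\beta+\epsilon\sin\beta,\ -\tau_i(\beta)+\tfrac\pi2+\beta-\epsilon\sin\beta\right),\quad i=1,2.$$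
   Context: Notation. $SU(2)$ is identified with the unit quaternions; $C(\mathbf i)$ is the set of pure (traceless) unit quaternions; $e^{tQ}=\cos t+\sin t\,Q$ for $Q\in C(\mathbf i)$. Bars denote inverses in groups and $[x,y]=xy\bar x\bar y$. With $\arcsin:[-1,1]\to[-\frac\pi2,\frac\pi2]$, set $\tau_1(\beta)=\arcsin(-\tfrac12\sin\beta)$ and $\tau_2(\beta)=\pi-\tau_1(\beta)$. Pillowcase. $R(S^2,\{m,b,c,n\})$ is the space of conjugacy classes of homomorphisms $\langle m,b,c,n\mid bm=cn\rangle\to SU(2)$ sending each generator into $C(\mathbf i)$, identified with $\mathbb{R}^2/\sim$, where $(\gamma,\theta)\sim(-\gamma,-\theta)\sim(\gamma+2\pi k,\theta+2\pi l)$ for $k,l\in\mathbb{Z}$, by letting $(\gamma,\theta)$ correspond to the class of $m\mapsto\mathbf i,\ b\mapsto e^{\gamma\mathbf k}\mathbf i,\ c\mapsto e^{\theta\mathbf k}\mathbf i,\ n\mapsto e^{(\theta-\gamma)\mathbf k}\mathbf i$. The tangle and the perturbation. $A_1\cup A_2\subset B^3$ is a pair of unknotted arcs in a 3-ball; the boundary meridians are $m,n$ (ends of $A_1$) and $b,c$ (ends of $A_2$). A Hopf link $H_1\cup H$, whose two components are joined by an arc $W$, is placed in the interior of $B^3$ away from the arcs. Two disjoint smaller balls $B^3_1,B^3_2$ lie in $B^3$: $B^3_1$ contains a piece of $A_2$, a piece of $H_1$ (with end meridians $a,d$), $H$, $W$ and a perturbation circle $P_1$ linking $A_2$ and $H$;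 $B^3_2$ contains a piece of $A_1$, the other piece of $H_1$, and a perturbation circle $P_2$ linking both. Let $h,w,p_1,p_2$ be meridians of $H,W,P_1,P_2$. The longitude of $P_1$ is $bh$ and the longitude of $P_2$ is $\bar am$. The fundamental group of the complement of the arcs, Hopf link, $W$, $P_1$ and $P_2$ is generated by $a,b,c,d,h,w,p_1,m,n,p_2$ with relations $$c=\bar p_1bp_1,\ d=\bar cba,\ [bh,p_1]=1,\ [a\bar p_1,h]=(ha)w(\bar a\bar h),\ d=\bar p_2ap_2,\ n=\bar p_2mp_2,\ [\bar am,p_2]=1 .$$ $R^\sharp_\pi(B^3,A_1\cup A_2)$ is the space of conjugacy classes of homomorphisms of this group to $SU(2)$ sending $a,b,c,d,h,m,n$ into $C(\mathbf i)$, sending $w$ to $-1$, and satisfying the perturbation conditions (with perturbation function $\epsilon\sin$ on $P_1$ and $2\epsilon\sin$ on $P_2$): if $bh\mapsto e^{\beta Q}$ with $Q\in C(\mathbf i)$ then $p_1\mapsto e^{\epsilon\sin(\beta)Q}$; if $\bar am\mapsto e^{\beta'Q'}$ with $Q'\in C(\mathbf i)$ then $p_2\mapsto e^{2\epsilon\sin(\beta')Q'}$. The restriction map restricts a representation to $m,b,c,n$. *)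

(* Defs.v *)
From HB Require Import structures.
From mathcomp Require Import all_boot all_order all_algebra generic_quotient.
From mathcomp Require Import all_classical all_reals all_analysis.
From mathcomp Require Import ring.

Set Implicit Arguments.
Unset Strict Implicit.
Unset Printing Implicit Defensive.

Import Order.TTheory GRing.Theory Num.Theory.
Import numFieldNormedType.Exports.
Local Open Scope classical_set_scope.
Local Open Scope ring_scope.
Local Open Scope quotient_scope.

Definition homeomorphism (S T : topologicalType) (f : S -> T) : Prop :=
  continuous f /\ exists g : T -> S, [/\ cancel f g, cancel g f & continuous g].

(* (a, b, c, d) stands for a + b i + c j + d k. *)
Definition quat (R : realType) : Type := (R * R * R * R)%type.
HB.instance Definition _ (R : realType) := Topological.on (quat R).

Section Quaternions.
Context {R : realType}.
Implicit Types p q : quat R.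

Definition qre q : R := q.1.1.1.

Definition qmul p q : quat R :=
  let: (a1, b1, c1, d1) := p in
  let: (a2, b2, c2, d2) := q in
  (a1 * a2 - b1 * b2 - c1 * c2 - d1 * d2,
   a1 * b2 + b1 * a2 + c1 * d2 - d1 * c2,
   a1 * c2 - b1 * d2 + c1 * a2 + d1 * b2,
   a1 * d2 + b1 * c2 - c1 * b2 + d1 * a2).

Definition qconj q : quat R := let: (a, b, c, d) := q in (a, - b, - c, - d).

Definition qnorm2 q : R :=
  let: (a, b, c, d) := q in a ^+ 2 + b ^+ 2 + c ^+ 2 + d ^+ 2.

(* cos t + (sin t) q. *)
Definition qexp (t : R) q : quat R :=
  let: (a, b, c, d) := q in
  (cos t + sin t * a, sin t * b, sin t * c, sin t * d).

Lemma qmulA : associative qmul.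
Proof.
move=> [[[? ?] ?] ?] [[[? ?] ?] ?] [[[? ?] ?] ?].
by rewrite /qmul; congr (_, _, _, _); ring.
Qed.

Lemma qmul1 q : qmul (1, 0, 0, 0) q = q.
Proof.
by move: q => [[[? ?] ?] ?]; rewrite /qmul /=; congr (_, _, _, _); ring.
Qed.

Lemma qmulq1 q : qmul q (1, 0, 0, 0) = q.
Proof.
by move: q => [[[? ?] ?] ?]; rewrite /qmul /=; congr (_, _, _, _); ring.
Qed.

Lemma qmul_conj q : qmul q (qconj q) = (qnorm2 q, 0, 0, 0).
Proof.
by move: q => [[[? ?] ?] ?]; rewrite /qmul /=; congr (_, _, _, _); ring.
Qed.

Lemma qconj_mul q : qmul (qconj q) q = (qnorm2 q, 0, 0, 0).
Proof.
by move: q => [[[? ?] ?] ?]; rewrite /qmul /=; congr (_, _, _, _); ring.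
Qed.

Lemma qnorm2M p q : qnorm2 (qmul p q) = qnorm2 p * qnorm2 q.
Proof.
by move: p q => [[[? ?] ?] ?] [[[? ?] ?] ?]; rewrite /qnorm2 /=; ring.
Qed.

Lemma qnorm2_conj q : qnorm2 (qconj q) = qnorm2 q.
Proof. by move: q => [[[? ?] ?] ?]; rewrite /qnorm2 /=; ring. Qed.

End Quaternions.

Definition unit_quat (R : realType) : set (quat R) := [set q | qnorm2 q = 1].
Arguments unit_quat : clear implicits.

(* Topologized as a subspace of R^4. *)
Definition SU2 (R : realType) : Type := set_type (unit_quat R).
HB.instance Definition _ (R : realType) := Topological.on (SU2 R).

Section SU2Group.
Context {R : realType}.

Definition quat_of (x : SU2 R) : quat R := \val x.

Definition mkSU2 (q : quat R) (hq : qnorm2 q = 1) : SU2 R :=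
  exist _ q (mem_set hq).

Lemma quat_ofP (x : SU2 R) : qnorm2 (quat_of x) = 1.
Proof. exact: set_valP x. Qed.

Lemma quat_of_inj : injective quat_of.
Proof. exact: val_inj. Qed.

Lemma SU2_mul_subproof (x y : SU2 R) :
  qnorm2 (qmul (quat_of x) (quat_of y)) = 1.
Proof. by rewrite qnorm2M !quat_ofP mulr1. Qed.

Lemma SU2_inv_subproof (x : SU2 R) : qnorm2 (qconj (quat_of x)) = 1.
Proof. by rewrite qnorm2_conj quat_ofP. Qed.

Lemma SU2_one_subproof : qnorm2 ((1, 0, 0, 0) : quat R) = 1.
Proof. by rewrite /qnorm2 /=; ring. Qed.

Definition SU2_mul (x y : SU2 R) : SU2 R := mkSU2 (SU2_mul_subproof x y).
Definition SU2_inv (x : SU2 R) : SU2 R := mkSU2 (SU2_inv_subproof x).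
Definition SU2_one : SU2 R := mkSU2 SU2_one_subproof.

Lemma SU2_mulA : associative SU2_mul.
Proof. by move=> x y z; apply: quat_of_inj; exact: qmulA. Qed.

Lemma SU2_mul1 : left_id SU2_one SU2_mul.
Proof. by move=> x; apply: quat_of_inj; exact: qmul1. Qed.

Lemma SU2_mulx1 : right_id SU2_one SU2_mul.
Proof. by move=> x; apply: quat_of_inj; exact: qmulq1. Qed.

Lemma SU2_mulVx : left_inverse SU2_one SU2_inv SU2_mul.
Proof.
by move=> x; apply: quat_of_inj; rewrite [LHS]qconj_mul quat_ofP.
Qed.

Lemma SU2_mulxV : right_inverse SU2_one SU2_inv SU2_mul.
Proof.
by move=> x; apply: quat_of_inj; rewrite [LHS]qmul_conj quat_ofP.
Qed.

End SU2Group.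

HB.instance Definition _ (R : realType) := isGroup.Build (SU2 R)
  (@SU2_mulA R) (@SU2_mul1 R) (@SU2_mulx1 R) (@SU2_mulVx R) (@SU2_mulxV R).

(* MathComp's [~ x, y] is x^-1 y^-1 x y, which is not the convention here. *)
Definition comm (G : groupType) (x y : G) : G := (x * y * x^-1 * y^-1)%g.

(* The set C(i) of pure unit quaternions. *)
Definition pure (R : realType) : set (SU2 R) := [set x | qre (quat_of x) = 0].
Arguments pure : clear implicits.

Section Elements.
Context {R : realType}.

Lemma SU2_ii_subproof : qnorm2 ((0, 1, 0, 0) : quat R) = 1.
Proof. by rewrite /qnorm2 /=; ring. Qed.

Lemma SU2_kk_subproof : qnorm2 ((0, 0, 0, 1) : quat R) = 1.
Proof. by rewrite /qnorm2 /=; ring. Qed.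

Lemma SU2_N1_subproof : qnorm2 ((-1, 0, 0, 0) : quat R) = 1.
Proof. by rewrite /qnorm2 /=; ring. Qed.

Definition ii : SU2 R := mkSU2 SU2_ii_subproof.
Definition SU2_N1 : SU2 R := mkSU2 SU2_N1_subproof.
Definition kk : pure R :=
  exist _ (mkSU2 SU2_kk_subproof) (mem_set (erefl (0 : R))).

Lemma expq_subproof (t : R) (Q : pure R) :
  qnorm2 (qexp t (quat_of (\val Q))) = 1.
Proof.
have := set_valP Q; have := quat_ofP (\val Q); rewrite /pure /qre /qexp /=.
case: (quat_of _) => [[[a b] c] d] /= nQ a0; rewrite a0 in nQ *.
transitivity (cos t ^+ 2 + sin t ^+ 2 * (0 ^+ 2 + b ^+ 2 + c ^+ 2 + d ^+ 2)).
  by ring.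
by rewrite nQ mulr1 cos2Dsin2.
Qed.

Definition expq (t : R) (Q : pure R) : SU2 R := mkSU2 (expq_subproof t Q).

End Elements.

(* A homomorphism from a presented group to SU(2) is encoded by its values on
   the generators X, i.e. by a function X -> SU(2) satisfying the relations.
   For a set S of such functions, conj_classes S is the space of conjugacy
   classes: S carries the subspace topology of the product SU(2)^X, and
   conj_classes S the quotient topology. *)
Section ConjClasses.
Context {R : realType} {X : Type} (S : set {ptws X -> SU2 R}).

Definition conj_rel (r s : S) : bool :=
  `[< exists g : SU2 R, forall x, set_val s x = (g * set_val r x * g^-1)%g >].

Lemma conj_rel_equiv : equiv_class_of conj_rel.
Proof.
split.
- by move=> r; apply/asboolP; exists 1%g => x; rewrite mul1g invg1 mulg1.
- have H : forall r s, conj_rel r s -> conj_rel s r.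
    move=> r s /asboolP[g gE]; apply/asboolP; exists (g^-1)%g => x.
    by rewrite gE invgK !mulgA mulVg mul1g -mulgA mulVg mulg1.
  by move=> r s; apply/idP/idP; exact: H.
- move=> s r t /asboolP[g gE] /asboolP[h hE]; apply/asboolP.
  by exists (h * g)%g => x; rewrite hE gE invgM !mulgA.
Qed.

Canonical conj_equiv := EquivRelPack conj_rel_equiv.

Definition conj_classes : Type := quotient_topology {eq_quot conj_equiv}.
HB.instance Definition _ := Topological.on conj_classes.
HB.instance Definition _ := Quotient.on conj_classes.

Definition conj_class (r : S) : conj_classes := \pi_conj_classes r.

Lemma conj_classP (r s : S) : conj_class r = conj_class s <->
  exists g : SU2 R, forall x, set_val s x = (g * set_val r x * g^-1)%g.
Proof.
split=> [/eqmodP/asboolP//|rs].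
by apply/eqmodP/asboolP.
Qed.

End ConjClasses.

Inductive sphere_gen := Sm | Sb | Sc | Sn.

Section Pillowcase.
Context {R : realType}.

Definition sphere_reps : set {ptws sphere_gen -> SU2 R} :=
  [set r | (r Sb * r Sm = r Sc * r Sn)%g /\ forall x, pure R (r x)].

(* R(S^2, {m, b, c, n}). *)
Definition R_sphere : Type := conj_classes sphere_reps.
HB.instance Definition _ := Topological.on R_sphere.

Definition pillow_rel (x y : R * R) : bool :=
  `[< exists k l : int,
      y = (x.1 + 2 * pi * k%:~R, x.2 + 2 * pi * l%:~R) \/
      y = (- x.1 + 2 * pi * k%:~R, - x.2 + 2 * pi * l%:~R) >].

Lemma pillow_rel_equiv : equiv_class_of pillow_rel.
Proof.
split.
- move=> [x y]; apply/asboolP; exists 0, 0; left.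
  by rewrite /= !mulr0 !addr0.
- have H : forall x y, pillow_rel x y -> pillow_rel y x.
    move=> [x1 x2] y /asboolP[k [l [->|->]]]; apply/asboolP.
      by exists (- k), (- l); left; rewrite /= !rmorphN /=; congr pair; ring.
    by exists k, l; right; rewrite /=; congr pair; ring.
  by move=> x y; apply/idP/idP; exact: H.
- move=> y [x1 x2] z /asboolP[k [l xy]] /asboolP[k' [l' yz]]; apply/asboolP.
  case: xy yz => -> [] ->.
  + by exists (k + k'), (l + l'); left; rewrite /= !rmorphD /=;
      congr pair; ring.
  + by exists (k' - k), (l' - l); right; rewrite /= !rmorphB /=;
      congr pair; ring.
  + by exists (k + k'), (l + l'); right; rewrite /= !rmorphD /=;
      congr pair; ring.
  + by exists (k' - k), (l' - l); left; rewrite /= !rmorphB /=;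
      congr pair; ring.
Qed.

Canonical pillow_equiv := EquivRelPack pillow_rel_equiv.

Definition pillowcase : Type := quotient_topology {eq_quot pillow_equiv}.
HB.instance Definition _ := Topological.on pillowcase.
HB.instance Definition _ := Quotient.on pillowcase.

Definition pillow_pt (g t : R) : pillowcase := \pi_pillowcase (g, t).

Definition pillow_fun (x : R * R) (s : sphere_gen) : SU2 R :=
  match s with
  | Sm => ii
  | Sb => expq x.1 kk * ii
  | Sc => expq x.2 kk * ii
  | Sn => expq (x.2 - x.1) kk * ii
  end%g.

Lemma pillow_funP (x : R * R) : sphere_reps (pillow_fun x).
Proof.
split; last first.
  by case; rewrite /pure /qre //=; ring.
apply: quat_of_inj; rewrite /= /quat_of /= sinB cosB.
have := cos2Dsin2 x.2; set C := cos x.2; set S := sin x.2 => H.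
set c := cos x.1; set s := sin x.1.
by congr (_, _, _, _); try ring; first
  [ transitivity (- c * (C ^+ 2 + S ^+ 2)); [by rewrite H; ring | by ring]
  | transitivity (- s * (C ^+ 2 + S ^+ 2)); [by rewrite H; ring | by ring] ].
Qed.

Definition pillow_rep (x : R * R) : @sphere_reps : Type :=
  exist _ (pillow_fun x : {ptws sphere_gen -> SU2 R})
    (mem_set (pillow_funP x)).

(* The identification of R^2/~ with R(S^2, {m, b, c, n}). *)
Definition pillow_to_R_sphere (p : pillowcase) : R_sphere :=
  conj_class (pillow_rep (repr p)).

Lemma expq_periodic (t : R) (k : int) (Q : pure R) :
  expq (t + 2 * pi * k%:~R) Q = expq t Q.
Proof.
suff H : forall (n : nat) (u : R),
    cos (u + 2 * pi * n%:R) = cos u /\ sin (u + 2 * pi * n%:R) = sin u.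
  have [ck sk] : cos (t + 2 * pi * k%:~R) = cos t /\
                 sin (t + 2 * pi * k%:~R) = sin t.
    case: k => n; first exact: H.
    have [<- <-] := H n.+1 (t + 2 * pi * (Negz n)%:~R).
    rewrite NegzE rmorphN /= -addrA -mulrDr.
    by rewrite -pmulrn addNr mulr0 addr0.
  by apply: quat_of_inj; rewrite /= /quat_of /= /qexp ck sk.
move=> n u; have -> : u + 2 * pi * n%:R = u + (pi *+ 2) *+ n.
  by rewrite -mulr_natl -(mulr_natl pi); ring.
by rewrite (periodicn (@cosD2pi R)) (periodicn (@sinD2pi R)).
Qed.

Lemma expqN_kk (t : R) : expq (- t) kk = (ii * expq t kk * ii^-1)%g.
Proof.
apply: quat_of_inj; rewrite /= /quat_of /= sinN cosN.
by congr (_, _, _, _); ring.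
Qed.

Lemma conj_mul_ii (x : SU2 R) :
  (ii * x * ii^-1 * ii = ii * (x * ii) * ii^-1)%g.
Proof. by rewrite -!mulgA mulVg mulgV. Qed.

(* The value of the identification does not depend on the representative. *)
Lemma pillow_to_R_sphereE (g t : R) :
  pillow_to_R_sphere (pillow_pt g t) = conj_class (pillow_rep (g, t)).
Proof.
apply/esym; rewrite /pillow_to_R_sphere /pillow_pt.
have /asboolP[k [l H]] : pillow_rel (g, t) (repr (\pi_pillowcase (g, t))).
  by apply/eqmodP; rewrite reprK.
apply/conj_classP; case: H => /= ->.
  exists 1%g => s; rewrite mul1g invg1 mulg1 !set_valE.
  case: s => /=; rewrite ?expq_periodic //.
  by rewrite opprD addrACA -mulrBr -rmorphB expq_periodic.
exists ii => s; rewrite !set_valE; case: s => /=.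
- by rewrite mulgK.
- by rewrite expq_periodic expqN_kk conj_mul_ii.
- by rewrite expq_periodic expqN_kk conj_mul_ii.
- rewrite opprD addrACA -mulrBr -rmorphB -opprD.
  by rewrite expq_periodic expqN_kk conj_mul_ii.
Qed.

End Pillowcase.

Inductive tangle_gen := Ta | Tb | Tc | Td | Th | Tw | Tp1 | Tm | Tn | Tp2.

Section Tangle.
Context {R : realType}.

Definition tangle_relations (r : tangle_gen -> SU2 R) : Prop :=
  let a := r Ta in let b := r Tb in let c := r Tc in let d := r Td in
  let h := r Th in let w := r Tw in let p1 := r Tp1 in
  let m := r Tm in let n := r Tn in let p2 := r Tp2 in
  ([/\ c = p1^-1 * b * p1, d = c^-1 * b * a & comm (b * h) p1 = 1] /\
   [/\ comm (a * p1^-1) h = (h * a) * w * (a^-1 * h^-1),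
       d = p2^-1 * a * p2, n = p2^-1 * m * p2 & comm (a^-1 * m) p2 = 1])%g.

(* The perturbation condition with function f at a circle whose longitude and
   meridian are sent to lambda and mu. *)
Definition perturbation (f : R -> R) (lambda mu : SU2 R) : Prop :=
  forall (beta : R) (Q : pure R),
    lambda = expq beta Q -> mu = expq (f beta) Q.

Definition tangle_reps (eps : R) : set {ptws tangle_gen -> SU2 R} :=
  [set r |
    [/\ tangle_relations r,
        [/\ pure R (r Ta), pure R (r Tb), pure R (r Tc) & pure R (r Td)] /\
        [/\ pure R (r Th), pure R (r Tm) & pure R (r Tn)],
        r Tw = SU2_N1,
        perturbation (fun beta => eps * sin beta) (r Tb * r Th)%g (r Tp1) &
        perturbation (fun beta => 2 * eps * sin beta)
          ((r Ta)^-1 * r Tm)%g (r Tp2)]].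

(* The space R^sharp_pi(B^3, A_1 u A_2). *)
Definition R_sharp (eps : R) : Type := conj_classes (tangle_reps eps).
HB.instance Definition _ (eps : R) := Topological.on (R_sharp eps).

Definition tangle_of_sphere (s : sphere_gen) : tangle_gen :=
  match s with Sm => Tm | Sb => Tb | Sc => Tc | Sn => Tn end.

Lemma boundary_relation (G : groupType) (a b c d m n p : G) :
  (d = c^-1 * b * a -> d = p^-1 * a * p -> n = p^-1 * m * p ->
   comm (a^-1 * m) p = 1 -> b * m = c * n)%g.
Proof.
move=> dE dE' ->; have := mulVKg a m.
move: (a^-1 * m)%g => x <-; rewrite /comm => xp1.
have xp : (x * p = p * x)%g by rewrite -[RHS]mul1g -xp1 !mulgA !mulgVK.
have -> : (p^-1 * (a * x) * p = d * x)%g by rewrite dE' -!mulgA xp.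
by rewrite dE !mulgA mulgV mul1g.
Qed.

Lemma restrict_subproof (eps : R) (r : tangle_reps eps) :
  sphere_reps (set_val r \o tangle_of_sphere).
Proof.
have [[[_ dE _] [_ dE' nE p2E]] [[_ pb pc _] [_ pm pn]] _ _ _] := set_valP r.
by split; [exact: boundary_relation dE dE' nE p2E | case].
Qed.

Definition restrict (eps : R) (r : tangle_reps eps) : @sphere_reps R : Type :=
  exist _ (set_val r \o tangle_of_sphere : {ptws sphere_gen -> SU2 R})
    (mem_set (restrict_subproof r)).

Definition restriction_map (eps : R) (x : R_sharp eps) : R_sphere :=
  conj_class (restrict (repr x)).

(* The value of the restriction map does not depend on the representative. *)
Lemma restriction_mapE (eps : R) (r : tangle_reps eps) :
  restriction_map (conj_class r) = conj_class (restrict r).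
Proof.
have /conj_classP[g H] : conj_class (repr (conj_class r)) = conj_class r.
  exact: reprK.
by apply/conj_classP; exists g => s; exact: H.
Qed.

End Tangle.

Section Circles.
Context {R : realType}.

Definition circle_rel (x y : R) : bool :=
  `[< exists k : int, y = x + 2 * pi * k%:~R >].

Lemma circle_rel_equiv : equiv_class_of circle_rel.
Proof.
split.
- by move=> x; apply/asboolP; exists 0; rewrite mulr0 addr0.
- have H : forall x y, circle_rel x y -> circle_rel y x.
    move=> x y /asboolP[k ->]; apply/asboolP.
    by exists (- k); rewrite rmorphN /=; ring.
  by move=> x y; apply/idP/idP; exact: H.
- move=> y x z /asboolP[k ->] /asboolP[l ->]; apply/asboolP.
  by exists (k + l); rewrite rmorphD /=; ring.
Qed.

Canonical circle_equiv := EquivRelPack circle_rel_equiv.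

(* S^1 = R / 2 pi Z. *)
Definition circle : Type := quotient_topology {eq_quot circle_equiv}.
HB.instance Definition _ := Topological.on circle.
HB.instance Definition _ := Quotient.on circle.

Definition circle_pt (beta : R) : circle := \pi_circle beta.

Definition tau1 (beta : R) : R := asin (- (1 / 2) * sin beta).
Definition tau2 (beta : R) : R := pi - tau1 beta.

(* The index i = 1, 2 is an element of 'I_2, which counts from 0. *)
Definition tau (i : 'I_2) : R -> R := if i == 0%N :> nat then tau1 else tau2.

End Circles.
Arguments circle : clear implicits.

(* Main.v *)
(* Every representation can be conjugated so that a p1^-1 = i and h = -j: the
   relation [a p1^-1, h] = -1 says exactly that a p1^-1 and h are orthogonal
   pure quaternions. As p1 is an exponential along the axis of bh, purity of
   a = i p1 forces that axis to be k, which fixes a, b, c, d and p1 in terms of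
   the angle beta of bh. On the other side p2^2 = p1^2, and for eps < 1/2 both
   square roots have positive real part, so p2 = p1 and sin beta' = sin beta / 2
   for the angle beta' of a^-1 m; the two possible signs of cos beta' are the
   two circles. A rotation about k then brings m to i.

   The traces of am, bh and ha are conjugation invariants that separate the
   points of the two circles, so the parametrization is a continuous bijection
   from a compact space that becomes an embedding in R^3 after composition with
   a continuous map, hence a homeomorphism. *)
Require Import Defs.
From HB Require Import structures.
From mathcomp Require Import all_boot all_order all_algebra generic_quotient.
From mathcomp Require Import all_classical all_reals all_analysis.
From mathcomp Require Import ring lra.

Set Implicit Arguments.
Unset Strict Implicit.
Unset Printing Implicit Defensive.

Import Order.TTheory GRing.Theory Num.Theory.
Import numFieldNormedType.Exports.
Local Open Scope classical_set_scope.
Local Open Scope ring_scope.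

(** * Polar coordinates, small angles and the functions [tau] *)

Section Trigonometry.
Context {R : realType}.
Implicit Types x y t : R.

Lemma polar_unit x y : x ^+ 2 + y ^+ 2 = 1 -> exists t, x = cos t /\ y = sin t.
Proof.
move=> xy1.
have x1 : -1 <= x <= 1 by nra.
have cosx : cos (acos x) = x by apply: acosK; rewrite in_itv.
have sinx : sin (acos x) = `|y|.
  by rewrite sin_acos// -xy1 addrC addKr sqrtr_sqr.
have [y0|y0] := leP 0 y.
  by exists (acos x); rewrite cosx sinx ger0_norm.
by exists (- acos x); rewrite cosN sinN cosx sinx ltr0_norm// opprK.
Qed.

Lemma polar x y : exists r t, [/\ x = r * cos t, y = r * sin t & 0 <= r].
Proof.
pose r := Num.sqrt (x ^+ 2 + y ^+ 2).
have r2 : r ^+ 2 = x ^+ 2 + y ^+ 2 by rewrite sqr_sqrtr// addr_ge0// sqr_ge0.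
have [r0|r0] := eqVneq r 0.
  exists 0, 0; move: r2; rewrite r0 !mul0r expr0n /= => /esym/eqP.
  by rewrite paddr_eq0 ?sqr_ge0// !sqrf_eq0 => /andP[/eqP-> /eqP->].
have [t [xE yE]] : exists t, x / r = cos t /\ y / r = sin t.
  apply: polar_unit; rewrite !expr_div_n -mulrDl -r2.
  by rewrite divff// sqrf_eq0.
by exists r, t; rewrite -xE -yE !(mulrC r) !divfK// sqrtr_ge0.
Qed.

Lemma cosD2piz t (k : int) : cos (t + 2 * pi * k%:~R) = cos t.
Proof.
have := congr1 (fun q : SU2 R => (quat_of q).1.1.1) (expq_periodic t k (@kk R)).
by rewrite /quat_of /= !mulr0 !addr0.
Qed.

Lemma sinD2piz t (k : int) : sin (t + 2 * pi * k%:~R) = sin t.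
Proof.
have := congr1 (fun q : SU2 R => (quat_of q).2) (expq_periodic t k (@kk R)).
by rewrite /quat_of /= !mulr1.
Qed.

Lemma cos_eq1 t : cos t = 1 -> exists k : int, t = 2 * pi * k%:~R.
Proof.
have pi0 : 0 < pi :> R := pi_gt0 R.
have pi20 : 0 < 2 * pi :> R by rewrite mulr_gt0.
(* The shift by 1/2 puts the remainder [u] into [-pi, pi], where the cosine determines the absolute
   value of the angle. *)
pose k := Num.floor (t / (2 * pi) + 1 / 2).
move=> ct; exists k.
pose u := t - 2 * pi * k%:~R.
have cu : cos u = 1.
  by rewrite /u -mulrN -rmorphN cosD2piz.
have := floor_itv (t / (2 * pi) + 1 / 2); rewrite -/k => /andP[k1 k2].
have tE : t = t / (2 * pi) * (2 * pi) by rewrite divfK ?gt_eqF.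
have u1 : - pi <= u.
  have := ler_wpM2r (ltW pi20) k1; rewrite /u [X in _ <= X - _]tE; lra.
have u2 : u <= pi.
  have := ler_wpM2r (ltW pi20) (ltW k2).
  rewrite rmorphD /= /u [X in X - _ <= _]tE; lra.
have u0 : `|u| = 0.
  apply: (@cos_inj R).
  - by rewrite in_itv /= normr_ge0 ler_norml u1.
  - by rewrite in_itv /= lexx ltW.
  - by rewrite cos_norm cu cos0.
by apply/eqP; rewrite -subr_eq0 -normr_eq0 -/u u0.
Qed.

Lemma cos_sin_inj x y : cos x = cos y -> sin x = sin y ->
  exists k : int, y = x + 2 * pi * k%:~R.
Proof.
move=> cxy sxy; have [|k kE] := @cos_eq1 (y - x).
  by rewrite cosB cxy sxy -!expr2 cos2Dsin2.
by exists k; rewrite -kE addrC subrK.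
Qed.

(** Since 1 <= pi/2, the interval [-1, 1] lies where the sine is injective. *)
Lemma sin_eq0_small x : -1 <= x <= 1 -> sin x = 0 -> x = 0.
Proof.
have p1 := pihalf_ge1 R.
by move=> x1 sx; apply: sin_inj; rewrite ?in_itv/= ?sin0//; lra.
Qed.

Lemma sin_inj_small x y : -1 <= x <= 1 -> -1 <= y <= 1 ->
  sin x = sin y -> x = y.
Proof.
have p1 := pihalf_ge1 R.
by move=> x1 y1 sx; apply: sin_inj; rewrite ?in_itv//=; lra.
Qed.

Lemma cos_gt0_small x : -1 < x < 1 -> 0 < cos x.
Proof. by have := pihalf_ge1 R => p1 x1; apply: cos_gt0_pihalf; lra. Qed.

Lemma sin_tau1 x : sin (tau1 x) = - (1 / 2) * sin x.
Proof.
have /andP[s1 s2] : -1 <= sin x <= 1 by rewrite sin_geN1 sin_le1.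
by rewrite /tau1 asinK// in_itv/=; lra.
Qed.

Lemma sin_tau (i : 'I_2) x : sin (tau i x) = - (1 / 2) * sin x.
Proof.
rewrite /tau; case: ifP => _; first exact: sin_tau1.
by rewrite /tau2 sinB sinpi cospi sin_tau1; ring.
Qed.

Lemma cos_tau1_gt0 x : 0 < cos (tau1 x).
Proof.
have /andP[s1 s2] : -1 <= sin x <= 1 by rewrite sin_geN1 sin_le1.
rewrite /tau1 cos_asin; last lra.
rewrite sqrtr_gt0; nra.
Qed.

Lemma cos_tau2 x : cos (tau2 x) = - cos (tau1 x).
Proof. by rewrite /tau2 cosB cospi sinpi; ring. Qed.

(** The two square roots of 1 - (sin x / 2)^2 are the cosines of [tau1 x] and [tau2 x]. *)
Lemma tau_exists x (y : R) : y ^+ 2 + (1 / 2 * sin x) ^+ 2 = 1 ->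
  exists i : 'I_2, y = cos (tau i x).
Proof.
move=> yx; have := cos2Dsin2 (tau1 x); rewrite sin_tau1 => cx.
have /eqP : y ^+ 2 = cos (tau1 x) ^+ 2 by lra.
rewrite eqf_sqr => /orP[]/eqP->; first by exists ord0.
by exists ord_max; rewrite /tau /= cos_tau2.
Qed.

(** The sign of the cosine alone tells [tau1] from [tau2], even at different angles; this keeps the
    two circles disjoint. *)
Lemma cos_tau_inj (i j : 'I_2) x y :
  cos (tau i x) = cos (tau j y) -> i = j.
Proof.
have := cos_tau1_gt0 x; have := cos_tau1_gt0 y.
case: i j => [[|[|//]] ?] [[|[|//]] ?]; rewrite /tau /= ?cos_tau2 => cx cy H;
  by [apply: val_inj | exfalso; lra].
Qed.

Lemma tau_periodic (i : 'I_2) x (k : int) :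
  tau i (x + 2 * pi * k%:~R) = tau i x.
Proof.
by rewrite /tau; case: ifP => _; rewrite /tau2 /tau1 sinD2piz.
Qed.

(** The factor 1/2 keeps the argument of [asin] inside the open interval (-1, 1), where [asin] is
    continuous. *)
Lemma continuous_tau (i : 'I_2) : continuous (tau i : R -> R).
Proof.
have ct1 : continuous (tau1 : R -> R).
  move=> x; have /andP[s1 s2] : -1 <= sin x <= 1 by rewrite sin_geN1 sin_le1.
  apply: (@continuous_comp _ _ _ (fun x => - (1 / 2) * sin x) (@asin R)).
    by apply: cvgM; [exact: cvg_cst | exact: continuous_sin].
  by apply: continuous_asin; lra.
rewrite /tau; case: ifP => _ // x.
by apply: cvgB; [exact: cvg_cst | exact: ct1].
Qed.

End Trigonometry.

(** * The group of all e^{tk} and e^{tk} i, and the perturbation condition in coordinates *)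

Section Planar.
Context {R : realType}.
Implicit Types (s t : R) (x y g : SU2 R) (Q : pure R).

Definition expk t : SU2 R := expq t kk.
(** These are the unit quaternions in the plane of i and j; together with the circle [expk] they
    form its normalizer. *)
Definition expki t : SU2 R := (expq t kk * ii)%g.

Lemma quat_of_expk t : quat_of (expk t) = (cos t, 0, 0, sin t).
Proof. by rewrite /quat_of /= mulr0 addr0 mulr1. Qed.

Lemma quat_of_expki t : quat_of (expki t) = (0, cos t, sin t, 0).
Proof. by rewrite /quat_of /=; congr (_, _, _, _); ring. Qed.

Lemma expk0 : expk 0 = 1%g.
Proof. by apply: quat_of_inj; rewrite quat_of_expk cos0 sin0. Qed.

Lemma expkM s t : (expk s * expk t)%g = expk (s + t).
Proof.
apply: quat_of_inj; rewrite quat_of_expk cosD sinD /quat_of /=.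
by congr (_, _, _, _); ring.
Qed.

Lemma expk_expkiM s t : (expk s * expki t)%g = expki (s + t).
Proof. by rewrite /expki mulgA expkM. Qed.

Lemma expki_expkM s t : (expki s * expk t)%g = expki (s - t).
Proof.
apply: quat_of_inj; rewrite quat_of_expki cosB sinB /quat_of /=.
by congr (_, _, _, _); ring.
Qed.

Lemma expkiM s t : (expki s * expki t)%g = expk (s - t + pi).
Proof.
apply: quat_of_inj; rewrite quat_of_expk cosDpi sinDpi cosB sinB /quat_of /=.
by congr (_, _, _, _); ring.
Qed.

Lemma expkV t : (expk t)^-1%g = expk (- t).
Proof.
by apply: quat_of_inj; rewrite quat_of_expk cosN sinN /quat_of /=;
  congr (_, _, _, _); ring.
Qed.

Lemma expkiV t : (expki t)^-1%g = expki (t + pi).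
Proof.
apply: quat_of_inj; rewrite quat_of_expki cosDpi sinDpi /quat_of /=.
by congr (_, _, _, _); ring.
Qed.

(** Rewriting with these rules reduces a group relation to an affine identity between angles modulo
    2 pi. *)
Definition expkE := (expkM, expk_expkiM, expki_expkM, expkiM, expkV, expkiV).

Lemma expki0 : expki 0 = ii.
Proof. by rewrite /expki -/(expk 0) expk0 mul1g. Qed.

Lemma expki_pure t : pure R (expki t).
Proof. by rewrite /pure /= quat_of_expki. Qed.

Lemma SU2_N1E : @SU2_N1 R = expk pi.
Proof. by apply: quat_of_inj; rewrite quat_of_expk cospi sinpi. Qed.

Lemma pure_coord (x : SU2 R) : pure R x -> exists b c d,
  quat_of x = (0, b, c, d) /\ b ^+ 2 + c ^+ 2 + d ^+ 2 = 1.
Proof.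
have := quat_ofP x; rewrite /pure /= /qre.
case: (quat_of x) => [[[a b] c] d] /=.
by move=> n a0; exists b, c, d; rewrite a0 in n *; split=> //;
  rewrite -n; ring.
Qed.

Lemma pureE Q : exists b c d,
  quat_of (val Q) = (0, b, c, d) /\ b ^+ 2 + c ^+ 2 + d ^+ 2 = 1.
Proof. by apply: pure_coord; exact: set_valP. Qed.

Lemma quat_of_expq t Q b c d : quat_of (val Q) = (0, b, c, d) ->
  quat_of (expq t Q) = (cos t, sin t * b, sin t * c, sin t * d).
Proof.
by move=> QE; transitivity (qexp t (quat_of (val Q)));
  rewrite // QE /= mulr0 addr0.
Qed.

Lemma mkpure (b c d : R) : b ^+ 2 + c ^+ 2 + d ^+ 2 = 1 ->
  exists Q, quat_of (val Q) = (0, b, c, d).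
Proof.
move=> n1; have nq : qnorm2 ((0, b, c, d) : quat R) = 1.
  by rewrite /qnorm2 /= -n1; ring.
by exists (exist _ (mkSU2 nq) (mem_set (erefl (0 : R)))).
Qed.

(* If [expq beta Q = expq beta' Q'] then [sin beta Q = sin beta' Q'], so
   [(sin beta', Q') = +- (sin beta, Q)] unless both sines vanish. *)
Lemma perturbation_expq (c beta : R) Q :
  perturbation (fun t => c * sin t) (expq beta Q) (expq (c * sin beta) Q).
Proof.
move=> beta' Q' /(congr1 (@quat_of R)).
have [x1 [x2 [x3 [QE nQ]]]] := pureE Q.
have [y1 [y2 [y3 [QE' nQ']]]] := pureE Q'.
rewrite (quat_of_expq _ QE) (quat_of_expq _ QE').
set s := sin beta; set s' := sin beta' => -[_ e1 e2 e3].
apply: quat_of_inj; rewrite (quat_of_expq _ QE) (quat_of_expq _ QE').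
have /eqP : s ^+ 2 = s' ^+ 2.
  rewrite -[LHS]mulr1 -nQ -[RHS]mulr1 -nQ' !mulrDr -!exprMn e1 e2 e3; ring.
have [s0|s0] := eqVneq s 0.
  rewrite s0 expr0n eq_sym sqrf_eq0 => /eqP->.
  by rewrite mulr0 sin0 !mul0r.
rewrite eqf_sqr => /orP[]/eqP ss'.
  rewrite -ss' in e1 e2 e3 *.
  by have [-> -> ->] : [/\ x1 = y1, x2 = y2 & x3 = y3]
    by split; exact: (mulfI s0).
have {}ss' : s' = - s by rewrite ss' opprK.
rewrite ss' in e1 e2 e3 *; rewrite mulrN cosN sinN !mulNr.
by have [-> -> ->] : [/\ x1 = - y1, x2 = - y2 & x3 = - y3];
  [split; apply: (mulfI s0); rewrite mulrN -mulNr | rewrite !mulrN].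
Qed.

(** The axis is eliminated: the imaginary part of [mu] is [k] times that of [lambda], which has
    length [s]. Stating [s * k = sin (c * s)] instead of a quotient also covers [s = 0]. *)
Lemma perturbation_quat (c : R) lambda mu a b1 b2 b3 :
  perturbation (fun t => c * sin t) lambda mu ->
  quat_of lambda = (a, b1, b2, b3) ->
  exists s : R, exists k : R,
   [/\ 0 <= s, s ^+ 2 = b1 ^+ 2 + b2 ^+ 2 + b3 ^+ 2, s * k = sin (c * s) &
       quat_of mu = (cos (c * s), k * b1, k * b2, k * b3)].
Proof.
move=> pert lE; have := quat_ofP lambda; rewrite lE /qnorm2 => n1.
pose s := Num.sqrt (b1 ^+ 2 + b2 ^+ 2 + b3 ^+ 2).
have s2 : s ^+ 2 = b1 ^+ 2 + b2 ^+ 2 + b3 ^+ 2.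
  by rewrite sqr_sqrtr// !addr_ge0// sqr_ge0.
have s0 : 0 <= s by rewrite sqrtr_ge0.
have [t [aE sE]] : exists t, a = cos t /\ s = sin t.
  by apply: polar_unit; rewrite s2 -n1; ring.
have [sz|snz] := eqVneq s 0.
  exists s, 0; rewrite sz !mulr0 sin0 cos0 !mul0r; split=> //.
    by rewrite -s2 sz.
  have [b10 b20 b30] : [/\ b1 = 0, b2 = 0 & b3 = 0].
    move: s2; rewrite sz expr0n /= => /esym/eqP.
    rewrite !paddr_eq0 ?addr_ge0 ?sqr_ge0// !sqrf_eq0.
    by move=> /andP[/andP[/eqP-> /eqP->] /eqP->].
  (* Here [lambda] is 1 or -1, so every axis fits and [kk] is as good as any. *)
  have := pert t kk; rewrite -sE sz mulr0 -/(expk 0) expk0 => ->//.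
  by apply: quat_of_inj; rewrite lE quat_of_expk -aE -sE sz b10 b20 b30.
have [Q QE] := @mkpure (b1 / s) (b2 / s) (b3 / s) ltac:(
  rewrite !expr_div_n -!mulrDl -s2 divff// sqrf_eq0; exact: snz).
exists s, (sin (c * s) / s); split=> //; first by rewrite mulrC divfK.
rewrite (pert t Q); first by rewrite (quat_of_expq _ QE) -sE;
  congr (_, _, _, _); rewrite mulrA mulrAC.
by apply: quat_of_inj; rewrite lE (quat_of_expq _ QE) -aE -sE;
  congr (_, _, _, _); rewrite mulrC divfK.
Qed.

End Planar.

(** * The explicit family of representations *)

Section Family.
Context {R : realType}.
Implicit Types (s t : R) (g : tangle_gen).

Lemma expk_mod s t (k : int) : s = t + 2 * pi * k%:~R -> expk s = expk t.
Proof. by move=> ->; exact: expq_periodic. Qed.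

Lemma expki_mod s t (k : int) : s = t + 2 * pi * k%:~R -> expki s = expki t.
Proof. by move=> st; congr (_ * _)%g; exact: expk_mod st. Qed.

(** The value at [Th] is chosen so that bh becomes e^{beta k}. The two perturbation meridians have
    the same value. *)
Definition circle_fun (eps : R) (i : 'I_2) (beta : R) g : SU2 R :=
  let tb := tau i beta in let phi := eps * sin beta in
  match g with
  | Ta => expki (- tb)
  | Tb => expki (- tb + (pi / 2 + beta + phi))
  | Tc => expki (- tb + (pi / 2 + beta - phi))
  | Td => expki (- tb - 2 * phi)
  | Th => expki (- tb - pi / 2 + phi)
  | Tw => expk pi
  | Tp1 | Tp2 => expk phi
  | Tm => expki 0
  | Tn => expki (- 2 * phi)
  end.

Lemma circle_funP eps i beta : tangle_reps eps (circle_fun eps i beta).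
Proof.
split.
- split; split; rewrite /comm /= !expkE.
  + by congr expki; ring.
  + by apply/esym/(@expki_mod _ _ 1); ring.
  + by rewrite -expk0; apply: (@expk_mod _ _ 0); ring.
  + by apply: (@expk_mod _ _ 0); field.
  + by congr expki; ring.
  + by congr expki; ring.
  + by rewrite -expk0; apply: (@expk_mod _ _ 0); ring.
- by split; split; exact: expki_pure.
- by rewrite /= SU2_N1E.
- rewrite /= expkE.
  have -> : expk (- tau i beta + (pi / 2 + beta + eps * sin beta) -
    (- tau i beta - pi / 2 + eps * sin beta) + pi) = expk beta.
    by apply: (@expk_mod _ _ 1); field.
  exact: perturbation_expq.
- rewrite /= !expkE.
  have -> : expk (- tau i beta + pi - 0 + pi) = expk (- tau i beta).
    by apply: (@expk_mod _ _ 1); ring.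
  (* This equality is the reason for the defining property sin tau = - sin beta / 2. *)
  have -> : eps * sin beta = 2 * eps * sin (- tau i beta).
    by rewrite sinN sin_tau; field.
  exact: perturbation_expq.
Qed.

End Family.

(** * Invariance of the defining conditions under conjugation *)

Section Conjugation.
Context {R : realType}.
Implicit Types (x y g : SU2 R).

Lemma quat_ofM x y : quat_of (x * y)%g = qmul (quat_of x) (quat_of y).
Proof. by []. Qed.

Lemma quat_ofV x : quat_of x^-1%g = qconj (quat_of x).
Proof. by []. Qed.

Lemma quat_of_conjg x g :
  quat_of (x ^ g)%g = qmul (qconj (quat_of g)) (qmul (quat_of x) (quat_of g)).
Proof. by []. Qed.

Lemma qre_conjg x g : qre (quat_of (x ^ g)%g) = qre (quat_of x).
Proof.
have := quat_ofP g; rewrite quat_of_conjg.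
case: (quat_of x) (quat_of g) => [[[x0 x1] x2] x3] [[[g0 g1] g2] g3] n.
by rewrite /qre -[RHS]mulr1 -n /=; ring.
Qed.

(** Conjugation is linear and fixes the real axis, so it rotates the axis [Q] and keeps the
    angle. *)
Lemma expq_conjg (Q : pure R) g :
  exists Q' : pure R, forall s, (expq s Q ^ g)%g = expq s Q'.
Proof.
have pQ : pure R ((val Q) ^ g)%g.
  by rewrite /pure /= qre_conjg; exact: set_valP Q.
pose Q' : pure R := exist _ ((val Q) ^ g)%g (mem_set pQ).
exists Q' => s; apply: quat_of_inj.
rewrite quat_of_conjg.
transitivity (qexp s
    (qmul (qconj (quat_of g)) (qmul (quat_of (val Q)) (quat_of g))));
  last by [].
have -> : quat_of (expq s Q) = qexp s (quat_of (val Q)) by [].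
have := quat_ofP g.
case: (quat_of (val Q)) (quat_of g) => [[[q0 q1] q2] q3] [[[g0 g1] g2] g3] n.
rewrite /=; congr (_, _, _, _); try ring.
by rewrite -[X in _ = X + _]mulr1 -n /=; ring.
Qed.

Lemma conjg_SU2_N1 g : (SU2_N1 ^ g)%g = SU2_N1.
Proof.
apply: quat_of_inj; rewrite quat_of_conjg.
have := quat_ofP g; case: (quat_of g) => [[[g0 g1] g2] g3] n.
transitivity ((- qnorm2 (g0, g1, g2, g3), 0, 0, 0) : quat R); last by rewrite n.
by rewrite /=; congr (_, _, _, _); ring.
Qed.

Lemma comm_conjg x y g : comm (x ^ g)%g (y ^ g)%g = (comm x y ^ g)%g.
Proof. by rewrite /comm !conjMg !conjVg. Qed.

Lemma perturbation_conjg f x y g :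
  perturbation f x y -> perturbation f (x ^ g)%g (y ^ g)%g.
Proof.
move=> pert beta Q xE; have [Q' QE] := expq_conjg Q g^-1%g.
have -> : y = expq (f beta) Q' by apply: pert; rewrite -QE -xE conjgK.
by rewrite -QE conjgKV.
Qed.

Lemma tangle_reps_conjg eps (r : tangle_gen -> SU2 R) g :
  tangle_reps eps r -> tangle_reps eps (fun z => r z ^ g)%g.
Proof.
move=> [[[cE dE e1] [e2 dE' nE e3]] [[pa pb pc pd] [ph pm pn]] wE p1E p2E].
split.
- split; split; rewrite /= -?conjVg -?conjMg ?comm_conjg -?conjMg.
  + by rewrite cE.
  + by rewrite dE.
  + by rewrite e1 conj1g.
  + by rewrite e2.
  + by rewrite dE'.
  + by rewrite nE.
  + by rewrite e3 conj1g.
- by split; split; rewrite /pure /= qre_conjg.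
- by rewrite wE conjg_SU2_N1.
- by rewrite /= -conjMg; exact: perturbation_conjg.
- by rewrite /= -conjVg -conjMg; exact: perturbation_conjg.
Qed.

End Conjugation.

(** * Rotations into standard position, and two facts on products of unit quaternions *)

Section Frames.
Context {R : realType}.
Implicit Types (x y g u h : SU2 R).

Lemma cos_half (t : R) : cos t = cos (t / 2) ^+ 2 - sin (t / 2) ^+ 2.
Proof. by rewrite [in LHS](splitr t) cosD; ring. Qed.

Lemma sin_half (t : R) : sin t = 2 * sin (t / 2) * cos (t / 2).
Proof. by rewrite [in LHS](splitr t) sinD; ring. Qed.

Lemma quat_of_ii : quat_of (@ii R) = (0, 1, 0, 0).
Proof. by []. Qed.

(** Conjugation by e^{(t/2) i} turns the plane of j and k by the full angle [t]. *)
Lemma rotate_about_ii (t x1 r : R) x :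
  quat_of x = (0, x1, r * cos t, r * sin t) ->
  exists g, (ii ^ g)%g = ii /\ quat_of (x ^ g)%g = (0, x1, r, 0).
Proof.
have cs := cos2Dsin2 (t / 2); 
have cs2 : (cos (t / 2) ^+ 2 + sin (t / 2) ^+ 2) ^+ 2 = 1 by rewrite cs expr1n.
have ng : qnorm2 ((cos (t / 2), sin (t / 2), 0, 0) : quat R) = 1.
  by rewrite /qnorm2 -[RHS]cs; ring.
move=> xE; exists (mkSU2 ng); split.
  apply: quat_of_inj; rewrite quat_of_conjg quat_of_ii.
  rewrite -[quat_of (mkSU2 ng)]/(cos (t / 2), sin (t / 2), 0, 0) /=.
  by congr (_, _, _, _); try ring; rewrite -[RHS]cs; ring.
rewrite quat_of_conjg xE -[quat_of (mkSU2 ng)]/(cos (t / 2), sin (t / 2), 0, 0).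
rewrite (cos_half t) (sin_half t) /=; congr (_, _, _, _); try ring.
(* Multiplying by a power of cos^2 + sin^2 = 1 makes both sides homogeneous, so that [ring]
   applies. *)
- by rewrite -[RHS]mulr1 -[X in _ = _ * X]cs; ring.
- by rewrite -[RHS]mulr1 -[X in _ = _ * X]cs2; ring.
Qed.

Lemma rotate_about_kk (t x3 r : R) x :
  quat_of x = (0, r * cos t, r * sin t, x3) ->
  quat_of (x ^ expk (t / 2))%g = (0, r, 0, x3).
Proof.
have cs := cos2Dsin2 (t / 2); 
have cs2 : (cos (t / 2) ^+ 2 + sin (t / 2) ^+ 2) ^+ 2 = 1 by rewrite cs expr1n.
move=> xE; rewrite quat_of_conjg xE quat_of_expk.
rewrite (cos_half t) (sin_half t) /=; congr (_, _, _, _); try ring.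
- by rewrite -[RHS]mulr1 -[X in _ = _ * X]cs2; ring.
- by rewrite -[RHS]mulr1 -[X in _ = _ * X]cs; ring.
Qed.

(** A rotation about i removes the k component; a rotation about k then carries the vector to i. *)
Lemma conjg_to_ii u : pure R u -> exists g, (u ^ g)%g = ii.
Proof.
move=> /pure_coord[b [c [d [uE n]]]].
have [r [t [cE dE r0]]] := polar c d.
have [v [bE rE]] : exists v, b = cos v /\ r = sin v.
  apply: polar_unit; rewrite -n cE dE -addrA; congr +%R.
  by rewrite !exprMn -mulrDr cos2Dsin2 mulr1.
rewrite cE dE in uE; have [g [_ ugE]] := rotate_about_ii uE.
exists (g * expk (v / 2))%g; apply: quat_of_inj; rewrite conjgM quat_of_ii.
by apply: rotate_about_kk; rewrite ugE bE rE !mul1r.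
Qed.

(** The hypothesis reads uh = -hu. For pure h the real part of this is orthogonality, and the
    symmetric imaginary part says that the real part of u annihilates h. *)
Lemma comm_N1_orthogonal u h : comm u h = SU2_N1 -> pure R h ->
  pure R u /\ forall u1 u2 u3 h1 h2 h3 : R, quat_of u = (0, u1, u2, u3) ->
    quat_of h = (0, h1, h2, h3) -> u1 * h1 + u2 * h2 + u3 * h3 = 0.
Proof.
move=> uh /pure_coord[h1 [h2 [h3 [hE nh]]]].
have {uh} : (u * h = SU2_N1 * (h * u))%g by rewrite -uh /comm !mulgA !mulgVK.
move=> /(congr1 quat_of); rewrite !quat_ofM hE.
rewrite -[quat_of SU2_N1]/(-1, 0, 0, 0) /pure /=.
case: (quat_of u) => [[[u0 u1] u2] u3] [e0 e1 e2 e3]; rewrite /qre /=; split.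
  rewrite -[u0]mulr1 -nh.
  have -> : u0 * (h1 ^+ 2 + h2 ^+ 2 + h3 ^+ 2) =
     h1 * (u0 * h1) + h2 * (u0 * h2) + h3 * (u0 * h3) by ring.
  have -> : u0 * h1 = 0 by lra.
  have -> : u0 * h2 = 0 by lra.
  have -> : u0 * h3 = 0 by lra.
  by ring.
by move=> ? ? ? ? ? ? [_ <- <- <-] [<- <- <-]; lra.
Qed.

Lemma orthogonal_frame u h : comm u h = SU2_N1 -> pure R h ->
  exists g, (u ^ g)%g = ii /\ (h ^ g)%g = expki (- (pi / 2)).
Proof.
move=> uh ph; have [pu _] := comm_N1_orthogonal uh ph.
have [g ug] := conjg_to_ii pu.
have ph' : pure R (h ^ g)%g by rewrite /pure /= qre_conjg.
have uh' : comm ii (h ^ g)%g = SU2_N1 by rewrite -ug comm_conjg uh conjg_SU2_N1.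
have [_ dot] := comm_N1_orthogonal uh' ph'.
have [h1 [h2 [h3 [hE nh]]]] := pure_coord ph'.
have h10 : h1 = 0 by have := dot _ _ _ _ _ _ quat_of_ii hE; lra.
(* The signs fit [rotate_about_ii] with radius -1, so that [h] lands on -j. *)
have [t [h2E h3E]] : exists t, - h2 = cos t /\ - h3 = sin t.
  by apply: polar_unit; rewrite -nh h10; ring.
have [g' [iig' hg']] : exists g', (ii ^ g')%g = ii /\
    quat_of ((h ^ g) ^ g')%g = (0, 0, -1, 0).
  by apply: (@rotate_about_ii t); rewrite hE h10 -h2E -h3E !mulN1r !opprK.
exists (g * g')%g; rewrite !conjgM ug iig'; split=> //.
apply: quat_of_inj.
by rewrite hg' quat_of_expki cosN sinN cos_pihalf sin_pihalf.
Qed.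

(** A unit quaternion with real part x0 satisfies x^2 = 2 x0 x - 1. The real part of x^2 thus gives
    x0 > 0, and the imaginary part then gives x. *)
Lemma square_inj x y : 0 < qre (quat_of x) -> 0 < qre (quat_of y) ->
  (x * x = y * y)%g -> x = y.
Proof.
move=> x0 y0 /(congr1 quat_of) xy; apply: quat_of_inj; move: x0 y0 xy.
rewrite !quat_ofM; have := quat_ofP x; have := quat_ofP y.
case: (quat_of x) (quat_of y) => [[[x0 x1] x2] x3] [[[y0 y1] y2] y3].
rewrite /qnorm2 /qre /= => ny nx px py [e0 e1 e2 e3].
have xy : x0 = y0.
  by apply/eqP; rewrite -(eqrXn2 (n := 2))// ?ltW//; apply/eqP; lra.
have xn0 : 2 * x0 != 0 by rewrite mulf_neq0 ?gt_eqF.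
by congr (_, _, _, _) => //; apply: (mulfI xn0); rewrite [in RHS]xy; lra.
Qed.

(** Pure unit quaternions satisfy x^-1 = -x; applied to x and to xy this gives y^-1 x = xy. *)
Lemma pure_mul_commute x y : pure R x -> pure R (x * y)%g ->
  (y^-1 * x = x * y)%g.
Proof.
rewrite /pure /= => px pxy; apply: quat_of_inj; move: px pxy.
rewrite !quat_ofM quat_ofV.
case: (quat_of x) (quat_of y) => [[[x0 x1] x2] x3] [[[y0 y1] y2] y3].
rewrite /qre /= => -> e; congr (_, _, _, _); lra.
Qed.

End Frames.

(** * Every representation is conjugate to a member of the family *)

Section NormalForm.
Context {R : realType}.
Implicit Types (eps : R) (r : tangle_gen -> SU2 R).

Lemma small_mul (c x : R) : 0 <= c < 1 -> -1 <= x <= 1 -> -1 < c * x < 1.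
Proof.
rewrite -ler_norml -ltr_norml => /andP[c0 c1] x1.
rewrite normrM (ger0_norm c0).
by rewrite (le_lt_trans _ c1)// ler_piMr.
Qed.

Lemma small_angle_eq0 eps (s : R) : 0 < eps < 1 / 2 -> 0 <= s <= 1 ->
  sin (eps * s) = 0 -> s = 0.
Proof.
move=> /andP[eps_gt0 eps_lt] /andP[s0 s1] /sin_eq0_small e.
have s01 : -1 <= s <= 1 by lra.
have sm := @small_mul eps s ltac:(lra) s01.
have /eqP : eps * s = 0 by apply: e; lra.
by rewrite mulf_eq0 gt_eqF//= => /eqP.
Qed.

Lemma normalized_rep_ball1 eps r : 0 < eps < 1 / 2 -> tangle_reps eps r ->
  (r Ta * (r Tp1)^-1)%g = ii -> r Th = expki (- (pi / 2)) ->
  exists beta : R, let phi := eps * sin beta in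
    [/\ r Ta = expki (- phi), r Tb = expki (pi / 2 + beta),
        r Tc = expki (pi / 2 + beta - 2 * phi), r Td = expki (- 3 * phi) &
        r Tp1 = expk phi].
Proof.
move=> eps_small [[[cE dE _] _] [[pa pb _ _] _] _ pert1 _] aE hE.
have {}aE : r Ta = (ii * r Tp1)%g by rewrite -aE mulgVK.
have [b1 [b2 [b3 [bE nb]]]] := pure_coord pb.
have lE : quat_of (r Tb * r Th)%g = (b2, b3, 0, - b1).
  rewrite quat_ofM bE hE quat_of_expki cosN sinN cos_pihalf sin_pihalf /=.
  by congr (_, _, _, _); ring.
have [s [k [s0 s2 sk p1E]]] := perturbation_quat pert1 lE.
(* Purity of [r Ta = ii * r Tp1], whose real part is [- k * b3]. *)
have b30 : b3 = 0.
  have kb3 : k * b3 = 0.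
    move: pa; rewrite /pure /= aE quat_ofM p1E quat_of_ii /qre /=; lra.
  (* If [k = 0], then sin(eps s) = 0 forces the whole imaginary part of bh to vanish, and [b3] with
     it. *)
  have [k0|k0] := eqVneq k 0; last by apply: (mulfI k0); rewrite mulr0.
  have : s = 0.
    by apply: (small_angle_eq0 eps_small); [nra | rewrite -sk k0 mulr0].
  by move=> sz; rewrite sz in s2; nra.
have [beta [b2E b1E]] : exists t, b2 = cos t /\ - b1 = sin t.
  by apply: polar_unit; rewrite -nb b30; ring.
have lE' : (r Tb * r Th)%g = expk beta.
  by apply: quat_of_inj; rewrite lE quat_of_expk -b2E -b1E b30.
have {}p1E : r Tp1 = expk (eps * sin beta) by apply: pert1; exact: lE'.
have {}bE : r Tb = expki (pi / 2 + beta).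
  apply: (mulIg (r Th)); rewrite lE' hE expkE.
  by apply/esym/(@expk_mod _ _ _ 1); field.
exists beta => /=.
have {}aE : r Ta = expki (- (eps * sin beta)).
  by rewrite aE p1E -expki0 expki_expkM sub0r.
have {}cE : r Tc = expki (pi / 2 + beta - 2 * (eps * sin beta)).
  by rewrite cE bE p1E !expkE; congr expki; ring.
split=> //; rewrite dE cE bE aE !expkE.
by apply: (@expki_mod _ _ _ 1); ring.
Qed.

Lemma normalized_rep_ball2 eps r (beta : R) : 0 < eps < 1 / 2 ->
  let phi := eps * sin beta in
  tangle_reps eps r -> r Ta = expki (- phi) -> r Td = expki (- 3 * phi) ->
  exists i : 'I_2,
    [/\ r Tm = expki (tau i beta - phi), r Tn = expki (tau i beta - 3 * phi) &
        r Tp2 = expk phi].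
Proof.
move=> /andP[eps_gt0 eps_lt] phi.
move=> [[_ [_ dE nE _]] [_ [_ pm pn]] _ _ pert2] aE d3.
set y := ((r Ta)^-1 * r Tm)%g in pert2.
have mE : r Tm = (r Ta * y)%g by rewrite /y mulVKg. clearbody y.
have /andP[sb1 sb2] : -1 <= sin beta <= 1 by rewrite sin_geN1 sin_le1.
have [y0 [y1 [y2 [y3 yE]]]] : exists y0 y1 y2 y3, quat_of y = (y0, y1, y2, y3).
  by case: (quat_of y) => [[[y0 y1] y2] y3]; exists y0, y1, y2, y3.
have ny : y0 ^+ 2 + y1 ^+ 2 + y2 ^+ 2 + y3 ^+ 2 = 1.
  by have := quat_ofP y; rewrite yE.
have [s [k [s0 s2 sk p2E]]] := perturbation_quat pert2 yE.
have s1 : -1 <= s <= 1 by nra.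
(* The bound eps < 1/2 makes [2 * eps * s] smaller than 1 in absolute value, so its cosine is
   positive. *)
have es := @small_mul (2 * eps) s ltac:(lra) s1.
have ephi : -1 < phi < 1 by apply: small_mul => //; lra.
have sphi : -1 <= sin beta <= 1 by rewrite sb1.
have p2 : r Tp2 = expk phi.
  (* The imaginary parts of p2 and [y] are proportional and a is pure, so purity of m = ay passes to
     a p2. *)
  have pap2 : ((r Tp2)^-1 * r Ta = r Ta * r Tp2)%g.
    apply: pure_mul_commute; first by rewrite aE; exact: expki_pure.
    move: pm; rewrite mE aE /pure /= !(quat_ofM (expki _)) yE p2E.
    rewrite quat_of_expki /qre /= => e.
    transitivity (k * (0 * y0 - cos (- phi) * y1 - sin (- phi) * y2 - 0 * y3));
      [by ring | by rewrite e mulr0].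
  apply: square_inj.
  - by rewrite p2E /qre /=; apply: cos_gt0_small.
  - by rewrite quat_of_expk /qre /=; apply: cos_gt0_small.
  (* Now d = p2^-1 a p2 = a p2^2, while the given values yield d = a e^{2 phi k}. *)
  - apply: (mulgI (r Ta)); rewrite mulgA -pap2 -dE d3 aE !expkE.
    by congr expki; ring.
have [k1 k2 k3] : [/\ k * y1 = 0, k * y2 = 0 & k * y3 = sin phi].
  by move: p2E; rewrite p2 quat_of_expk => -[_ <- <- <-].
have [y10 y20 y3E] : [/\ y1 = 0, y2 = 0 & y3 = 1 / 2 * sin beta].
  (* For [k = 0] both sin(2 eps s) and sin phi vanish; the angles being small, [s] and sin beta
     vanish too. *)
  have [kz|kn] := eqVneq k 0.
    have sz : s = 0.
      suff : 2 * s = 0 by lra.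
      have /(sin_eq0_small _) e : sin (2 * eps * s) = 0 by rewrite -sk kz mulr0.
      have /eqP : eps * (2 * s) = 0 by rewrite mulrA (mulrC eps); apply: e; lra.
      by rewrite mulf_eq0 gt_eqF//= => /eqP.
    have /(sin_eq0_small _) e : sin phi = 0 by rewrite -k3 kz mul0r.
    have /eqP : eps * sin beta = 0 by apply: e; lra.
    rewrite mulf_eq0 gt_eqF//= => /eqP ->; rewrite sz in s2.
    by split; nra.
  have y10 : y1 = 0 by apply: (mulfI kn); rewrite mulr0.
  have y20 : y2 = 0 by apply: (mulfI kn); rewrite mulr0.
  split=> //.
  (* Only [s], the absolute value of [y3], is known to enter; oddness of the sine removes the
     sign. *)
  have sinE : sin (2 * eps * y3) = sin phi.
    have /eqP : s ^+ 2 = y3 ^+ 2 by rewrite s2 y10 y20; ring.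
    rewrite eqf_sqr -k3 => /orP[]/eqP sy.
      by rewrite -sy -sk mulrC.
    have -> : y3 = - s by rewrite sy opprK.
    by rewrite mulrN sinN -sk; ring.
  have y31 : -1 <= y3 <= 1 by nra.
  have ey3 := @small_mul (2 * eps) y3 ltac:(lra) y31.
  have e : 2 * eps * y3 = phi by apply: sin_inj_small => //; lra.
  apply: (mulfI (lt0r_neq0 eps_gt0)); rewrite -/phi; move: e.
  rewrite /phi; lra.
have [|i y0E] := @tau_exists _ beta y0.
  by rewrite -y3E -ny y10 y20; ring.
have {}yE : y = expk (- tau i beta).
  apply: quat_of_inj; rewrite yE quat_of_expk y10 y20 y3E y0E cosN sinN sin_tau.
  by congr (_, _, _, _); ring.
exists i; split=> //.
  by rewrite mE aE yE expkE; congr expki; ring.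
by rewrite nE p2 mE aE yE !expkE; congr expki; ring.
Qed.

Lemma circle_fun_surj eps r : 0 < eps < 1 / 2 -> tangle_reps eps r ->
  exists i beta g, forall z, r z = (g * circle_fun eps i beta z * g^-1)%g.
Proof.
move=> eps_small rP.
have [[_ [e2 _ _ _]] [_ [ph _ _]] wE _ _] := rP.
(* The right side of the relation is a conjugate of the central element -1. *)
have e2' : comm (r Ta * (r Tp1)^-1)%g (r Th) = SU2_N1.
  have NC x : (x * @SU2_N1 R = SU2_N1 * x)%g.
    apply: quat_of_inj; rewrite !quat_ofM -[quat_of SU2_N1]/(-1, 0, 0, 0).
    by case: (quat_of x) => [[[? ?] ?] ?] /=; congr (_, _, _, _); ring.
  by rewrite e2 wE NC !mulgA !mulgK.
have [g [ug hg]] := orthogonal_frame e2' ph.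
have rgP := tangle_reps_conjg g rP.
have ug' : ((r Ta ^ g) * (r Tp1 ^ g)^-1)%g = ii by rewrite -conjVg -conjMg.
have [beta [aE bE cE dE p1E]] := normalized_rep_ball1 eps_small rgP ug' hg.
have [i [mE nE p2E]] := normalized_rep_ball2 eps_small rgP aE dE.
(* Conjugation by e^{(theta/2) k} adds theta to the angle of [expki]; this theta carries i to the
   value found for m. *)
pose phi := eps * sin beta; pose q := expk ((tau i beta - phi) / 2).
exists i, beta, (g * q)%g => z.
suff zE : (r z ^ g = q * circle_fun eps i beta z * q^-1)%g.
  by rewrite invgM -mulgA -!mulgA (mulgA (circle_fun _ _ _ _)) mulgA
    -(conjgK g (r z)) zE /conjg invgK !mulgA.
case: z => /=; rewrite ?aE ?bE ?cE ?dE ?p1E ?p2E ?mE ?nE ?hg ?wE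
  ?conjg_SU2_N1 ?SU2_N1E /q !expkE; try by
  [congr expki; rewrite /phi; field | congr expk; rewrite /phi; field].
Qed.

End NormalForm.

(** * Product, subspace and quotient topologies *)

Section Topology.

Lemma ptws_eval_continuous (X : Type) (Y : topologicalType) (x : X) :
  continuous (fun f : {ptws X -> Y} => f x).
Proof.
move=> f A fxA.
have /cvg_sup/(_ x) : f --> f by apply: cvg_id.
by apply; exact: (initial_continuous fxA).
Qed.

Lemma continuous_ptws (T : topologicalType) (X : Type) (Y : topologicalType)
  (f : T -> {ptws X -> Y}) :
  (forall x, continuous (fun t => f t x)) -> continuous f.
Proof.
move=> cf t; apply/cvg_sup => x.
exact: (@continuous_comp_initial _ _ _ (fun g : X -> Y => g x)
  (f : T -> initial_topology (fun g : X -> Y => g x)) (cf x) t).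
Qed.

Lemma continuous_set_type (T X : topologicalType) (A : set X) (f : T -> A) :
  continuous (fun t => set_val (f t)) -> continuous f.
Proof. by move=> cf; exact: (@continuous_comp_initial A T X set_val f). Qed.

Lemma set_val_continuous (X : topologicalType) (A : set X) :
  continuous (set_val : A -> X).
Proof. exact: initial_continuous. Qed.

Lemma continuous_pair (T U V : topologicalType) (f : T -> U) (g : T -> V) :
  continuous f -> continuous g -> continuous (fun t => (f t, g t)).
Proof. by move=> cf cg t; apply: cvg_pair; [exact: cf | exact: cg]. Qed.

(** Closedness is tested in [U] rather than in the quotient [T]: a closed set of [S] is compact, its
    image in [U] is compact and hence closed, and the preimage of that under [h] is its image under
    [f]. *)
Lemma compact_bijection_homeomorphism (S T U : topologicalType)
    (f : S -> T) (h : T -> U) :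
  compact [set: S] -> hausdorff_space U -> continuous f -> continuous h ->
  (forall y, exists x, f x = y) -> injective (h \o f) -> homeomorphism f.
Proof.
move=> cS hU cf ch fsurj hfinj.
pose g y := projT1 (cid (fsurj y)).
have gK : cancel g f by move=> y; rewrite /g; case: (cid _).
have fK : cancel f g by move=> x; apply: hfinj; rewrite /= gK.
split=> //; exists g; split=> //.
apply/continuous_closedP => C cC.
have -> : g @^-1` C = h @^-1` ((h \o f) @` C).
  apply/seteqP; split=> y /=.
    by move=> Cgy; exists (g y); rewrite //= gK.
  move=> [x Cx hx]; suff -> : g y = x by [].
  by apply: hfinj; rewrite /= gK.
move/continuous_closedP: (ch); apply.
apply: compact_closed => //; apply: continuous_compact.
  apply: continuous_subspaceT => x.
  by apply: continuous_comp; [exact: cf | exact: ch].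
exact: subclosed_compact cC cS _.
Qed.

End Topology.

(** * Continuity of maps into SU(2) and of traces of products *)

Section Continuity.
Context {R : realType}.

Lemma continuous_SU2 (T : topologicalType) (f : T -> SU2 R) (a b c d : T -> R) :
  continuous a -> continuous b -> continuous c -> continuous d ->
  (forall t, quat_of (f t) = (a t, b t, c t, d t)) -> continuous f.
Proof.
move=> ca cb cc cd fE; apply: continuous_set_type.
have -> : (fun t => set_val (f t)) = (fun t => (a t, b t, c t, d t)).
  by apply/funext => t; rewrite -fE.
exact: continuous_pair (continuous_pair (continuous_pair ca cb) cc) cd.
Qed.

Lemma quat_of_continuous : continuous (quat_of : SU2 R -> R * R * R * R).
Proof. exact: set_val_continuous. Qed.

Lemma continuous_qre_mul (T : topologicalType) (f g : T -> SU2 R) :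
  continuous f -> continuous g ->
  continuous (fun t => qre (quat_of (f t * g t)%g)).
Proof.
have compC (U V W : topologicalType) (u : U -> V) (v : V -> W) :
    continuous u -> continuous v -> continuous (v \o u).
  by move=> cu cv t; apply: continuous_comp; [exact: cu|exact: cv].
have fstC (U V : topologicalType) : continuous (@fst U V).
  by move=> t; exact: cvg_fst.
have sndC (U V : topologicalType) : continuous (@snd U V).
  by move=> t; exact: cvg_snd.
have H (k : T -> SU2 R) : continuous k -> [/\
    continuous (fun t => (quat_of (k t)).1.1.1),
    continuous (fun t => (quat_of (k t)).1.1.2),
    continuous (fun t => (quat_of (k t)).1.2) &
    continuous (fun t => (quat_of (k t)).2)].
  move=> ck; have cq := compC _ _ _ _ _ ck quat_of_continuous.
  have cq1 := compC _ _ _ _ _ cq (fstC _ _).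
  have cq2 := compC _ _ _ _ _ cq1 (fstC _ _).
  split.
  - exact: compC _ _ _ _ _ cq2 (fstC _ _).
  - exact: compC _ _ _ _ _ cq2 (sndC _ _).
  - exact: compC _ _ _ _ _ cq1 (sndC _ _).
  - exact: compC _ _ _ _ _ cq (sndC _ _).
move=> /H[f0 f1 f2 f3] /H[g0 g1 g2 g3].
have -> : (fun t => qre (quat_of (f t * g t)%g)) = (fun t =>
  (quat_of (f t)).1.1.1 * (quat_of (g t)).1.1.1 -
  (quat_of (f t)).1.1.2 * (quat_of (g t)).1.1.2 -
  (quat_of (f t)).1.2 * (quat_of (g t)).1.2 -
  (quat_of (f t)).2 * (quat_of (g t)).2).
  apply/funext => t; rewrite quat_ofM.
  by case: (quat_of (f t)) (quat_of (g t)) => [[[? ?] ?] ?] [[[? ?] ?] ?].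
move=> t; do !apply: cvgB; apply: cvgM;
  [exact: f0 | exact: g0 | exact: f1 | exact: g1
  | exact: f2 | exact: g2 | exact: f3 | exact: g3].
Qed.

End Continuity.

(** * Compactness of the circle and continuity of the family *)

Section CircleTopology.
Context {R : realType}.

Lemma circle_ptP (x y : R) :
  circle_pt x = circle_pt y <-> exists k : int, y = x + 2 * pi * k%:~R.
Proof. by split=> [/eqmodP/asboolP//|xy]; apply/eqmodP/asboolP. Qed.

Lemma circle_compact : compact [set: circle R].
Proof.
have -> : [set: circle R] = circle_pt @` `[0, 2 * pi].
  apply/seteqP; split=> // c _.
  have pi20 : 0 < 2 * pi :> R by rewrite mulr_gt0// pi_gt0.
  pose t : R := repr c; pose k := Num.floor (t / (2 * pi)).
  exists (t - 2 * pi * k%:~R); last first.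
    transitivity (circle_pt t); last exact: reprK.
    by apply/circle_ptP; exists k; rewrite subrK.
  have := floor_itv (t / (2 * pi)); rewrite -/k => /andP[k1 k2].
  have tE : t = t / (2 * pi) * (2 * pi) by rewrite divfK ?gt_eqF.
  have := ler_wpM2r (ltW pi20) k1; have := ler_wpM2r (ltW pi20) (ltW k2).
  by rewrite -tE rmorphD /= in_itv /=; lra.
apply: continuous_compact; last exact: segment_compact.
exact/continuous_subspaceT/pi_continuous.
Qed.

Lemma continuous_expk (T : topologicalType) (f : T -> R) :
  continuous f -> continuous (fun t => expk (f t)).
Proof.
move=> cf; apply: (@continuous_SU2 _ _ _ (fun t => cos (f t))
    (cst 0) (cst 0) (fun t => sin (f t))).
- by move=> t; apply: continuous_comp; [exact: cf | exact: continuous_cos].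
- by move=> t; exact: cvg_cst.
- by move=> t; exact: cvg_cst.
- by move=> t; apply: continuous_comp; [exact: cf | exact: continuous_sin].
- by move=> t; rewrite quat_of_expk.
Qed.

Lemma continuous_expki (T : topologicalType) (f : T -> R) :
  continuous f -> continuous (fun t => expki (f t)).
Proof.
move=> cf; apply: (@continuous_SU2 _ _ _ (cst 0) (fun t => cos (f t))
    (fun t => sin (f t)) (cst 0)).
- by move=> t; exact: cvg_cst.
- by move=> t; apply: continuous_comp; [exact: cf | exact: continuous_cos].
- by move=> t; apply: continuous_comp; [exact: cf | exact: continuous_sin].
- by move=> t; exact: cvg_cst.
- by move=> t; rewrite quat_of_expki.
Qed.

Lemma continuous_circle_fun (eps : R) (i : 'I_2) :
  continuous (fun beta => circle_fun eps i beta : {ptws tangle_gen -> SU2 R}).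
Proof.
have C (k : R) : continuous (fun _ : R => k) by move=> t; exact: cvg_cst.
have D (f g : R -> R) : continuous f -> continuous g ->
    continuous (fun t => f t + g t).
  by move=> cf cg t; apply: cvgD; [exact: cf|exact: cg].
have M (f g : R -> R) : continuous f -> continuous g ->
    continuous (fun t => f t * g t).
  by move=> cf cg t; apply: cvgM; [exact: cf|exact: cg].
have N (f : R -> R) : continuous f -> continuous (fun t => - f t).
  by move=> cf t; apply: cvgN; exact: cf.
have I : continuous (fun t : R => t) by move=> t; exact: cvg_id.
have S : continuous (fun t : R => sin t) := @continuous_sin R.
have Tu : continuous (fun t => tau i t) := @continuous_tau R i.
apply: continuous_ptws; case=> /=;
  first [apply: continuous_expki | apply: continuous_expk];
  repeat first [exact: C | exact: I | exact: S | exact: Tu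
    | apply: (N) | apply: (D) | apply: (M)].
Qed.

End CircleTopology.

(** * The parametrization and the trace invariants that invert it *)

Section Circles.
Context {R : realType} (eps : R).

Definition circle_rep (i : 'I_2) (beta : R) : tangle_reps eps : Type :=
  exist _ (circle_fun eps i beta : {ptws tangle_gen -> SU2 R})
    (mem_set (circle_funP eps i beta)).

Definition circle_map (x : {i : 'I_2 & circle R}) : R_sharp eps :=
  conj_class (circle_rep (projT1 x) (repr (projT2 x))).

Lemma circle_rep_periodic i (x y : R) : circle_pt x = circle_pt y ->
  circle_rep i x = circle_rep i y.
Proof.
move=> /circle_ptP[k ->]; apply: val_inj; apply/funext => z.
(* Only the values at [Tb] and [Tc] contain beta outside [tau] and the sine. *)
rewrite /= /circle_fun tau_periodic sinD2piz; case: z => //=.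
- by apply/esym/(@expki_mod _ _ _ k); ring.
- by apply/esym/(@expki_mod _ _ _ k); ring.
Qed.

Lemma circle_mapE (i : 'I_2) (beta : R) :
  circle_map (existT _ i (circle_pt beta)) = conj_class (circle_rep i beta).
Proof.
by congr conj_class; apply: circle_rep_periodic; exact: reprK.
Qed.

Lemma circle_map_continuous : continuous circle_map.
Proof.
suff cc i : continuous (fun c : circle R => conj_class (circle_rep i (repr c))).
  exact: sigT_continuous cc.
apply: (@repr_comp_continuous _ _ _ (fun t => conj_class (circle_rep i t))).
  move=> t; apply: (@continuous_comp _ _ _ (circle_rep i) (@conj_class _ _ _)).
    exact: (@continuous_set_type _ _ _ (circle_rep i)
      (@continuous_circle_fun _ eps i)).
  exact: pi_continuous.
by move=> a b /eqP ab; apply/eqP; congr conj_class; exact: circle_rep_periodic.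
Qed.

(** Real parts are half the traces. On the family the first detects the circle, the second gives cos
    beta, and the third recovers sin beta. *)
Definition traces (r : tangle_reps eps) : R * R * R :=
  (qre (quat_of (set_val r Ta * set_val r Tm)%g),
   qre (quat_of (set_val r Tb * set_val r Th)%g),
   qre (quat_of (set_val r Th * set_val r Ta)%g)).

Lemma traces_conj (r s : tangle_reps eps) :
  conj_class r = conj_class s -> traces r = traces s.
Proof.
move=> /conj_classP[g H]; rewrite /traces !H.
have E (x y : SU2 R) :
    (g * x * g^-1 * (g * y * g^-1) = (x * y) ^ g^-1)%g.
  by rewrite /conjg invgK !mulgA mulgVK.
by rewrite !E !qre_conjg.
Qed.

Lemma traces_circle_rep i beta : traces (circle_rep i beta) =
  (- cos (tau i beta), cos beta, - sin (eps * sin beta)).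
Proof.
rewrite /traces !set_valE /= !expkE !quat_of_expk /qre /=.
congr (_, _, _).
- by rewrite subr0 cosDpi cosN.
- transitivity (cos (beta + 2 * pi * 1%:~R)); last exact: cosD2piz.
  by congr cos; field.
- by rewrite -cosDpihalf; congr cos; field.
Qed.

Definition class_traces (c : R_sharp eps) : R * R * R := traces (repr c).

Lemma class_tracesE (r : tangle_reps eps) :
  class_traces (conj_class r) = traces r.
Proof. by apply: traces_conj; exact: reprK. Qed.

Lemma class_traces_continuous : continuous class_traces.
Proof.
apply: (@repr_comp_continuous _ _ _ traces); last first.
  by move=> a b /eqP ab; apply/eqP; exact: traces_conj.
have ev (z : tangle_gen) : continuous (fun r : tangle_reps eps => set_val r z).
  move=> r; apply: (@continuous_comp _ _ _ set_val
      (fun f : {ptws tangle_gen -> SU2 R} => f z)).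
    exact: set_val_continuous.
  exact: ptws_eval_continuous.
have evM y z := continuous_qre_mul (ev y) (ev z).
exact: continuous_pair (continuous_pair (evM _ _) (evM _ _)) (evM _ _).
Qed.

Lemma circle_map_homeomorphism : 0 < eps < 1 / 2 -> homeomorphism circle_map.
Proof.
move=> eps_small.
apply: (@compact_bijection_homeomorphism _ _ _ circle_map class_traces).
- apply: (@sigT_compact 'I_2 (fun=> circle R)) => [|_].
    exact: finite_finset.
  exact: circle_compact.
- exact: norm_hausdorff.
- exact: circle_map_continuous.
- exact: class_traces_continuous.
- move=> c.
  have [i [beta [g H]]] := circle_fun_surj eps_small (set_valP (repr c)).
  exists (existT _ i (circle_pt beta)); rewrite circle_mapE -[c]reprK.
  by apply/conj_classP; exists g.
- move=> [i c] [j d].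
  rewrite /circle_map /= !class_tracesE.
  rewrite !traces_circle_rep => -[/oppr_inj ct cb /oppr_inj sb].
  have /andP[e0 e1] := eps_small.
  (* In this range the sine is injective, so the third trace determines sin beta. *)
  have small (x : R) : -1 <= eps * sin x <= 1.
    have sx : -1 <= sin x <= 1 by rewrite sin_geN1 sin_le1.
    by have := small_mul (c := eps) ltac:(lra) sx; lra.
  have sE : sin (repr c) = sin (repr d).
    apply: (mulfI (lt0r_neq0 e0)).
    exact: (sin_inj_small (small _) (small _) sb).
  rewrite (cos_tau_inj ct); congr existT.
  rewrite -[c]reprK -[d]reprK.
  exact/circle_ptP/cos_sin_inj.
Qed.

End Circles.

(** * The parametrization and the restriction to the pillowcase *)

Theorem theorem9p1 (R : realType) :
  exists2 eps0 : R, 0 < eps0 & forall eps : R, 0 < eps < eps0 ->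
  exists2 Phi : {i : 'I_2 & circle R} -> R_sharp eps,
    homeomorphism Phi &
    forall (i : 'I_2) (beta : R),
      (exists2 rho : tangle_reps eps,
        Phi (existT _ i (circle_pt beta)) = conj_class rho &
        let r := set_val rho in
        [/\ r Tm = ii,
            r Tb = (expq (- tau i beta) kk *
                    expq (pi / 2 + beta + eps * sin beta) kk * ii)%g,
            r Tc = (expq (- tau i beta) kk *
                    expq (pi / 2 + beta - eps * sin beta) kk * ii)%g &
            r Tn = (expq (- 2 * eps * sin beta) kk * ii)%g] /\
        [/\ r Ta = (expq (- tau i beta) kk * ii)%g &
            r Td = (expq (- tau i beta - 2 * eps * sin beta) kk * ii)%g]) /\
      restriction_map (Phi (existT _ i (circle_pt beta))) =
        pillow_to_R_sphere
          (pillow_pt (- tau i beta + pi / 2 + beta + eps * sin beta)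
                     (- tau i beta + pi / 2 + beta - eps * sin beta)).
Proof.
exists (1 / 2) => [|eps eps_small]; first lra.
exists (@circle_map R eps); first exact: circle_map_homeomorphism.
move=> i beta; rewrite circle_mapE; split.
  exists (circle_rep eps i beta) => //=; rewrite !set_valE /=.
  split; split.
  - exact: expki0.
  - by rewrite -mulgA -/(expki _) -/(expk _) expkE.
  - by rewrite -mulgA -/(expki _) -/(expk _) expkE.
  - by rewrite mulrA.
  - by [].
  - by rewrite mulrA.
(* The two boundary representations agree generator by generator, without a conjugation. *)
rewrite restriction_mapE pillow_to_R_sphereE; congr conj_class.
apply: val_inj; apply/funext; case; rewrite /= set_valE /=.
- exact: expki0.
- by congr (expq _ _ * _)%g; ring.
- by congr (expq _ _ * _)%g; ring.
- by congr (expq _ _ * _)%g; ring.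
Qed.
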